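(* For $0\le\delta\le1$ let $f_\delta=1_{\{0\}}+\delta\,1_{\{1\}}$, a function on $\mathbb{Z}$. Then $\gamma(f_\delta)=1+\delta$, and more generally for $1<p<\infty$ and $1/p+1/q=1$, \[ \gamma_p(f_\delta)\ge\frac{p^{1/p}q^{1/q}}{2}(1+\delta). \]
   Context: For nonnegative functions $f,g$ on $\mathbb{Z}$, $(f\star g)(x)=\max_t f(t)g(x-t)$ (max-convolution). For nonnegative $f\in\ell^1(\mathbb{Z})$, $\gamma_p(f)=\inf_{g,h}\frac{\|f\star g\star h\|_1}{\|g\|_p\|h\|_q}$, the infimum over nonzero nonnegative $g,h\in\ell^1(\mathbb{Z})$, and $\gamma=\gamma_2$. *)

(* Defs.v *)
From mathcomp Require Import all_boot all_order all_algebra.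
From mathcomp Require Import all_classical all_reals all_analysis.
Set Implicit Arguments. Unset Strict Implicit. Unset Printing Implicit Defensive.
Import Order.TTheory GRing.Theory Num.Theory.
Local Open Scope classical_set_scope.
Local Open Scope ring_scope.

Section Defs.
Variable R : realType.

Definition maxconv (f g : int -> R) : int -> R :=
  fun x => sup [set f t * g (x - t) | t in [set: int]].

Definition l1norm (g : int -> R) : \bar R := \esum_(x in [set: int]) (`|g x|)%:E.

Definition lpnorm (p : R) (g : int -> R) : \bar R :=
  ((\esum_(x in [set: int]) (powR `|g x| p)%:E) `^ p^-1)%E.

Definition conj_exp (p : R) : R := p / (p - 1).

Definition admissible (g : int -> R) : Prop :=
  (forall x, 0 <= g x) /\ (exists x, g x != 0) /\ (l1norm g < +oo)%E.

Definition gamma_p (p : R) (f : int -> R) : \bar R :=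
  ereal_inf [set r | exists g h, admissible g /\ admissible h /\
    r = (l1norm (maxconv (maxconv f g) h) *
         ((fine (lpnorm p g) * fine (lpnorm (conj_exp p) h))^-1)%:E)%E].

Definition gamma (f : int -> R) : \bar R := gamma_p 2 f.

Definition fdelta (delta : R) : int -> R :=
  fun x => (if x == 0 then 1 else 0) + delta * (if x == 1 then 1 else 0).

End Defs.

(* Main.v *)
Require Import Defs.
From mathcomp Require Import all_boot all_order all_algebra.
From mathcomp Require Import all_classical all_reals all_analysis.
From mathcomp Require Import zify ring lra.
Set Implicit Arguments. Unset Strict Implicit. Unset Printing Implicit Defensive.
Import Order.TTheory GRing.Theory Num.Theory.
Local Open Scope classical_set_scope.
Local Open Scope ring_scope.

(**
If [G] and [H] have the same maximum [M] and [min (G x) (H y) <= U (x + y)], then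
comparing level sets through [|A + B| >= |A| + |B| - 1] gives
[sum U >= sum G + sum H - M].  For the lower bound normalize [g] and [h] to have
maximum 1, write [delta = eps ^ m], and spread each value over [m] points by
[g' (x m + r) = g x eps ^ r] for [0 <= r < m], similarly for [h].  The
max-convolution of [g'] and [h'] at [z m + r] is at most
[max (u z) (delta u (z - 1)) eps ^ r] with [u] the max-convolution of [g] and [h],
that is, [eps ^ r] times the value of the triple max-convolution at [z].
Applying the level set bound to [g' ^ p] and [h' ^ q], Young's inequality for each
[r], and [(1 + eps) sum eps ^ (2 r) = (1 + delta) sum eps ^ r] gives the claim up
to an error [1 / sum eps ^ r <= 1 / (m delta)], which vanishes as [m] grows.
The upper bound for [p = 2] is attained at the indicator of 0.
*)

(** * Sumsets and level sets on finite sets of integers *)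

Lemma seq_min_mem (d : Order.disp_t) (T : orderType d) (s : seq T) :
  s != [::] -> exists2 a, a \in s & {in s, forall x, (a <= x)%O}.
Proof.
elim: s => [//|x [|y s] IH] _.
  by exists x; rewrite ?mem_head// => z; rewrite inE => /eqP ->.
have [//|a ain amin] := IH.
have [xa|ax] := leP x a.
  exists x; first exact: mem_head.
  by move=> z; rewrite inE => /predU1P[->//|/amin]; exact: le_trans.
exists a; first by rewrite inE ain orbT.
by move=> z; rewrite inE => /predU1P[->|/amin//]; exact: ltW.
Qed.

Lemma seq_max_mem (d : Order.disp_t) (T : orderType d) (s : seq T) :
  s != [::] -> exists2 a, a \in s & {in s, forall x, (x <= a)%O}.
Proof. exact: (@seq_min_mem _ T^d). Qed.

(* The translates [X + min Y] and [max X + Y] share exactly one point. *)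
Lemma size_sumset_ge (X Y Z : seq int) : X != [::] -> Y != [::] ->
  uniq X -> uniq Y -> {in X & Y, forall x y, x + y \in Z} ->
  (size X + size Y <= (size Z).+1)%N.
Proof.
move=> X0 Y0 uX uY XYZ.
have [a aX amax] := seq_max_mem X0.
have [b bY bmin] := seq_min_mem Y0.
pose s := [seq x + b | x <- X] ++ [seq a + y | y <- rem b Y].
have us : uniq s.
  rewrite cat_uniq (map_inj_uniq (addIr b)) (map_inj_uniq (addrI a)).
  rewrite rem_uniq// uX andbT/=; apply/hasPn => _ /mapP[y + ->].
  rewrite mem_rem_uniq// !inE => /andP[yb yY].
  apply/negP => /mapP[x xX e].
  have := amax _ xX; have := bmin _ yY; move/eqP: yb; lia.
have sZ : {subset s <= Z}.
  move=> z; rewrite mem_cat => /orP[] /mapP[x xin ->]; apply: XYZ => //.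
  exact: mem_rem xin.
have := uniq_leq_size us sZ.
rewrite size_cat !size_map size_rem//.
by case: (Y) Y0 => //= ? ? _; lia.
Qed.

(* Peel off the bottom layer, whose width is controlled by [size_sumset_ge], and
   recurse on the points strictly above it. *)
Lemma sum_layers_ge (R : realDomainType) (M : R) (X Y Z : seq int)
    (G H U : int -> R) :
  uniq X -> uniq Y -> uniq Z -> {in X & Y, forall x y, x + y \in Z} ->
  {in X, forall x, 0 <= G x <= M} -> {in Y, forall y, 0 <= H y <= M} ->
  (exists2 x, x \in X & G x = M) -> (exists2 y, y \in Y & H y = M) ->
  (forall z, 0 <= U z) ->
  {in X & Y, forall x y, Num.min (G x) (H y) <= U (x + y)} ->
  \sum_(x <- X) G x + \sum_(y <- Y) H y <= \sum_(z <- Z) U z + M.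
Proof.
have [n] := ubnP (size X + size Y).
elim: n => // n IH in M X Y G H U *; rewrite ltnS => nXY uX uY uZ XYZ GM HM.
move=> [x0 x0X Gx0] [y0 y0Y Hy0] U0 GHU.
have X0 : X != [::] by case: (X) x0X.
have Y0 : Y != [::] by case: (Y) y0Y.
have [|v vin vmin] := @seq_min_mem _ _ ([seq G x | x <- X] ++ [seq H y | y <- Y]).
  by case: (X) x0X.
have vG x : x \in X -> v <= G x by move=> xX; rewrite vmin// mem_cat map_f.
have vH y : y \in Y -> v <= H y by move=> yY; rewrite vmin// mem_cat map_f// orbT.
have v0 : 0 <= v.
  by move: vin; rewrite mem_cat => /orP[] /mapP[x xin ->];
    [case/andP: (GM _ xin)|case/andP: (HM _ xin)].
have vM : v <= M by rewrite -Gx0 vG.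
(* The true sumset is needed beside [Z]: only on [S] is [U] known to be at least [v]. *)
pose S := undup [seq x + y | x <- X, y <- Y].
have SP x y : x \in X -> y \in Y -> x + y \in S.
  by move=> xX yY; rewrite mem_undup; apply/allpairsP; exists (x, y).
have Sv z : z \in S -> v <= U z.
  rewrite mem_undup => /allpairsP[[x y] /= [xX yY ->]].
  by apply: le_trans (GHU _ _ xX yY); rewrite le_min vG ?vH.
have sizeS := size_sumset_ge X0 Y0 uX uY SP.
have countS : (size S <= count (mem S) Z)%N.
  rewrite -size_filter; apply: uniq_leq_size; first exact: undup_uniq.
  move=> z zS; rewrite mem_filter inE zS/=.
  by move: zS; rewrite mem_undup => /allpairsP[[x y] /= [xX yY ->]]; exact: XYZ.
(* Truncating [U - v] at 0 loses at least [v] at each of the at least |X| + |Y| - 1 points of [S];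
   the missing 1 is the [v] on the right. *)
have peel : v * (size X + size Y)%:R + \sum_(z <- Z) Num.max 0 (U z - v)
    <= \sum_(z <- Z) U z + v.
  apply: (@le_trans _ _ (v * (count (mem S) Z)%:R + v +
      \sum_(z <- Z) Num.max 0 (U z - v))).
    rewrite lerD2r [_ * (count _ _)%:R]mulr_natr -mulrSr -(mulr_natr v).
    by rewrite ler_wpM2l// ler_nat (leq_trans sizeS)// ltnS.
  rewrite addrAC lerD2r -sum1_count natr_sum mulr_sumr [in X in X + _]big_mkcond.
  rewrite -big_split/=; apply: ler_sum => z _.
  case: ifPn => [zS|_]; rewrite ?mulr1 ?add0r.
    by rewrite max_r ?subr_ge0 ?Sv// addrC subrK.
  by rewrite ge_max U0/= gerBl.
have sumB (s : seq int) (F : int -> R) : {in s, forall x, v <= F x} ->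
    \sum_(x <- s) F x =
    v * (size s)%:R + \sum_(x <- [seq x <- s | v < F x]) (F x - v).
  elim: s => [|x s IHs] vF; first by rewrite !big_nil mulr0 addr0.
  rewrite big_cons IHs; last by move=> y ys; apply: vF; rewrite inE ys orbT.
  rewrite /= -natr1 mulrDr mulr1; have := vF x (mem_head _ _).
  rewrite le_eqVlt => /predU1P[<-|vx]; first by rewrite ltxx; ring.
  by rewrite vx big_cons; ring.
rewrite (sumB X)// (sumB Y)//.
set X' := seq.filter _ X; set Y' := seq.filter _ Y.
suff : \sum_(x <- X') (G x - v) + \sum_(y <- Y') (H y - v) <=
    \sum_(z <- Z) Num.max 0 (U z - v) + (M - v).
  by move: peel; rewrite natrD; lra.
(* If [v = M], nothing lies strictly above [v]: both lists are empty and the induction hypothesis,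
   which needs maximizers, is not called. *)
have [vM'|Mv] := ltP v M; last first.
  have -> : X' = [::].
    apply/eqP; rewrite -[_ == _]negbK -has_filter; apply/hasPn => x xX.
    by rewrite -leNgt; apply: le_trans Mv; case/andP: (GM _ xX).
  have -> : Y' = [::].
    apply/eqP; rewrite -[_ == _]negbK -has_filter; apply/hasPn => x xX.
    by rewrite -leNgt; apply: le_trans Mv; case/andP: (HM _ xX).
  rewrite !big_nil addr0 addr_ge0 ?subr_ge0//.
  by apply: sumr_ge0 => z _; rewrite le_max lexx.
apply: IH; rewrite ?filter_uniq//.
(* The point where [v] is attained is discarded, so the total size drops. *)
- apply: leq_trans nXY; rewrite -(count_predC (fun x => v < G x) X).
  rewrite -(count_predC (fun x => v < H x) Y) -!size_filter.
  rewrite -/X' -/Y'; move: vin; rewrite mem_cat => /orP[] /mapP[x xin vx].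
    have : x \in seq.filter (predC (fun x => v < G x)) X.
      by rewrite mem_filter xin/= -vx ltxx.
    by clearbody X' Y'; case: (seq.filter _ X) => //= *; clear; lia.
  have : x \in seq.filter (predC (fun x => v < H x)) Y.
    by rewrite mem_filter xin/= -vx ltxx.
  by clearbody X' Y'; case: (seq.filter _ Y) => //= *; clear; lia.
- by move=> x y; rewrite !mem_filter => /andP[_ xX] /andP[_ yY]; exact: XYZ.
- move=> x; rewrite mem_filter => /andP[vx xX].
  by rewrite subr_ge0 (ltW vx) lerD2r; case/andP: (GM _ xX).
- move=> x; rewrite mem_filter => /andP[vx xX].
  by rewrite subr_ge0 (ltW vx) lerD2r; case/andP: (HM _ xX).
- by exists x0; rewrite ?mem_filter ?x0X ?Gx0 ?vM'.
- by exists y0; rewrite ?mem_filter ?y0Y ?Hy0 ?vM'.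
- by move=> z; rewrite le_max lexx.
move=> x y; rewrite !mem_filter => /andP[vx xX] /andP[vy yY].
rewrite le_max; apply/orP; right.
by rewrite -addr_minl lerD2r GHU.
Qed.

(** * Spreading each integer over a block of [m] integers *)

Definition dilate (m : nat) (s : seq int) : seq int :=
  [seq x * m%:Z + r%:Z | x <- s, r <- iota 0 m].

Lemma divz_dilate (m r : nat) (x : int) : (r < m)%N ->
  ((x * m%:Z + r%:Z) %/ m%:Z)%Z = x.
Proof. by move=> rm; rewrite divzMDl ?divz_small ?addr0//; lia. Qed.

Lemma modz_dilate (m r : nat) (x : int) : (r < m)%N ->
  ((x * m%:Z + r%:Z) %% m%:Z)%Z = r.
Proof. by move=> rm; rewrite modzMDl modz_small//; lia. Qed.

(** Addition with carry in base [m]. A carry moves to the next block and releases a factor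
    [eps ^+ m], which will be [delta]. *)
Lemma dilate_add (m r r' : nat) (x y : int) : (r < m)%N -> (r' < m)%N ->
  exists k, (k < m)%N /\
  ((x * m%:Z + r%:Z + (y * m%:Z + r'%:Z) = (x + y) * m%:Z + k%:Z /\
    (r + r' = k)%N) \/
   (x * m%:Z + r%:Z + (y * m%:Z + r'%:Z) = (x + y + 1) * m%:Z + k%:Z /\
    (r + r' = m + k)%N)).
Proof.
move=> rm rm'; have [lt|ge] := ltnP (r + r')%N m.
  by exists (r + r')%N; split=> //; left; split=> //; rewrite PoszD; ring.
exists (r + r' - m)%N; split; first lia.
by right; split; [rewrite -subzn// PoszD; ring|rewrite subnKC].
Qed.

Lemma mem_dilate (m r : nat) (s : seq int) (x : int) :
  x \in s -> (r < m)%N -> x * m%:Z + r%:Z \in dilate m s.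
Proof.
by move=> xs rm; apply/allpairsP; exists (x, r); rewrite /= mem_iota.
Qed.

Lemma dilateP (m : nat) (s : seq int) (z : int) : z \in dilate m s ->
  exists x r, [/\ x \in s, (r < m)%N & z = x * m%:Z + r%:Z].
Proof.
case/allpairsP => -[x r] /= [xs]; rewrite mem_iota => /= rm ->.
by exists x, r.
Qed.

Lemma dilate_uniq (m : nat) (s : seq int) : uniq s -> uniq (dilate m s).
Proof.
move=> us; apply: allpairs_uniq => //; first exact: iota_uniq.
move=> _ _ /allpairsP[[x r] /= [_ + ->]] /allpairsP[[x' r'] /= [_ + ->]] /=.
rewrite !mem_iota /= !add0n => rm rm' e; congr (_, _).
  by rewrite -(divz_dilate x rm) e divz_dilate.
by have := modz_dilate x rm; rewrite e modz_dilate// => -[].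
Qed.

Section Spread.
Variables (R : realType) (eps : R) (m : nat).
Hypotheses (eps01 : 0 <= eps <= 1) (m0 : (0 < m)%N).

Let eps0 : 0 <= eps. Proof. by case/andP: eps01. Qed.

Definition spread (F : int -> R) (z : int) : R :=
  F (z %/ m%:Z)%Z * eps ^+ `|(z %% m%:Z)%Z|%N.

Lemma spreadE F x r : (r < m)%N -> spread F (x * m%:Z + r%:Z) = F x * eps ^+ r.
Proof. by move=> rm; rewrite /spread divz_dilate// modz_dilate. Qed.

(** Taken with [phi] the powers [p] and [q] and the identity. Multiplicativity is asked only at the
    values that occur, because [powRM] needs nonnegative factors. *)
Lemma sum_spread (phi : R -> R) F (s : seq int) :
  (forall x r, x \in s -> phi (F x * eps ^+ r) = phi (F x) * phi (eps ^+ r)) ->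
  \sum_(z <- dilate m s) phi (spread F z) =
  (\sum_(x <- s) phi (F x)) * \sum_(r < m) phi (eps ^+ r).
Proof.
move=> phiM.
rewrite big_allpairs_dep/= mulr_suml big_seq [RHS]big_seq; apply: eq_bigr => x xs.
rewrite mulr_sumr -{1}[m in iota 0 m]subn0 big_mkord.
by apply: eq_bigr => r _; rewrite spreadE ?phiM.
Qed.

(** Two blocks add up into two consecutive blocks, so [Z] must contain both [x + y] and [x + y + 1].
    The final 1 is the common maximum of the two spread powers. *)
Lemma spread_sumset_ge (p q : R) (X Y Z : seq int) (g h w : int -> R) :
  0 < p -> 0 < q -> p^-1 + q^-1 = 1 ->
  uniq X -> uniq Y -> uniq Z ->
  {in X & Y, forall x y, x + y \in Z /\ x + y + 1 \in Z} ->
  {in X, forall x, 0 <= g x <= 1} -> {in Y, forall y, 0 <= h y <= 1} ->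
  (exists2 x, x \in X & g x = 1) -> (exists2 y, y \in Y & h y = 1) ->
  (forall z, 0 <= w z) ->
  {in X & Y, forall x y, g x * h y <= w (x + y) /\
    eps ^+ m * (g x * h y) <= w (x + y + 1)} ->
  (\sum_(x <- X) g x `^ p) * (\sum_(r < m) (eps ^+ r) `^ p) +
  (\sum_(y <- Y) h y `^ q) * (\sum_(r < m) (eps ^+ r) `^ q) <=
  (\sum_(z <- Z) w z) * (\sum_(r < m) eps ^+ r) + 1.
Proof.
move=> p0 q0 pq uX uY uZ XYZ g01 h01 [x0 x0X gx0] [y0 y0Y hy0] w0 ghw.
rewrite -(sum_spread (phi := fun t => t `^ p)); last first.
  by move=> x r /g01/andP[? _]; rewrite powRM// exprn_ge0.
rewrite -(sum_spread (phi := fun t => t `^ q)); last first.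
  by move=> x r /h01/andP[? _]; rewrite powRM// exprn_ge0.
rewrite -(sum_spread (phi := id))//.
have epsX1 r : 0 <= eps ^+ r <= 1.
  by rewrite exprn_ge0//= exprn_ile1//; case/andP: eps01.
have spread01 (s : seq int) F : {in s, forall x, 0 <= F x <= 1} ->
    {in dilate m s, forall z, 0 <= spread F z <= 1}.
  move=> F01 _ /dilateP[x [r [xs rm ->]]]; rewrite spreadE//.
  have /andP[? ?] := F01 _ xs; have /andP[? ?] := epsX1 r.
  by rewrite mulr_ge0//= mulr_ile1.
have pow01 (t : R) a : 0 < t -> 0 <= a <= 1 -> 0 <= a `^ t <= 1.
  move=> t0 /andP[a0 a1]; rewrite powR_ge0//=.
  have -> : 1 = 1 `^ t :> R by rewrite powR1.
  by rewrite ge0_ler_powR// ?nnegrE// ltW.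
apply: (@sum_layers_ge _ 1 (dilate m X) (dilate m Y)); rewrite ?dilate_uniq//.
- move=> _ _ /dilateP[x [r [xs rm ->]]] /dilateP[y [r' [ys rm' ->]]].
  have [XYZ0 XYZ1] := XYZ _ _ xs ys.
  by have [k [km [[-> _]|[-> _]]]] := dilate_add x y rm rm'; exact: mem_dilate.
- by move=> z zin; apply: pow01 => //; exact: spread01 zin.
- by move=> z zin; apply: pow01 => //; exact: spread01 zin.
- exists (x0 * m%:Z + 0%N%:Z); first exact: mem_dilate.
  by rewrite spreadE// gx0 expr0 mulr1 powR1.
- exists (y0 * m%:Z + 0%N%:Z); first exact: mem_dilate.
  by rewrite spreadE// hy0 expr0 mulr1 powR1.
- by move=> z; rewrite mulr_ge0// exprn_ge0.
move=> a b aX bY.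
have /andP[ga0 _] := spread01 _ _ g01 _ aX.
have /andP[hb0 _] := spread01 _ _ h01 _ bY.
(* The minimum [s] of [a ^ p] and [b ^ q] is at most [a b]: write [s] as the product of its powers
   [1/p] and [1/q] and bound each factor. *)
apply: (@le_trans _ _ (spread g a * spread h b)).
  set s := Num.min _ _.
  have s0 : 0 <= s by rewrite le_min !powR_ge0.
  rewrite -[leLHS]powRr1// -pq powRD; last by rewrite pq oner_eq0.
  have sg : s <= spread g a `^ p by rewrite ge_min lexx.
  have sh : s <= spread h b `^ q by rewrite ge_min lexx orbT.
  have root_le (t c : R) : 0 < t -> 0 <= c -> s <= c `^ t -> s `^ t^-1 <= c.
    move=> t0 c0 sc; rewrite -[leRHS]powRr1// -(divff (lt0r_neq0 t0)) powRrM.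
    by rewrite ge0_ler_powR// ?invr_ge0 ?nnegrE ?powR_ge0// ltW.
  by rewrite ler_pM ?powR_ge0// root_le.
move: aX bY => /dilateP[x [r [xs rm ->]]] /dilateP[y [r' [ys rm' ->]]].
have [ghw0 ghw1] := ghw _ _ xs ys.
rewrite !spreadE// mulrACA -exprD.
(* Without carry the first bound on [w] applies; with carry the factor [eps ^+ m] calls for the
   second. *)
have [k [km [[-> ->]|[-> ->]]]] := dilate_add x y rm rm'; rewrite spreadE//.
  by rewrite ler_wpM2r// exprn_ge0.
by rewrite exprD mulrA ler_wpM2r ?exprn_ge0// mulrC.
Qed.

End Spread.

(** * The inequality for finite sums *)

(** Young's inequality for [(p A)^(1/p) t] and [(q B)^(1/q) t]; the factors [p] and [q] cancel its
    weights [1/p] and [1/q]. *)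
Lemma young_powR (R : realType) (p q t A B : R) :
  0 < p -> 0 < q -> p^-1 + q^-1 = 1 -> 0 <= t -> 0 <= A -> 0 <= B ->
  p `^ p^-1 * q `^ q^-1 * (A `^ p^-1 * B `^ q^-1) * t ^+ 2 <=
  A * t `^ p + B * t `^ q.
Proof.
move=> p0 q0 pq t0 A0 B0.
have pK (s a : R) : 0 < s -> 0 <= a ->
    (s `^ s^-1 * a `^ s^-1 * t) `^ s / s = a * t `^ s.
  move=> s0 a0; rewrite !powRM ?mulr_ge0 ?powR_ge0// -!powRrM mulVf ?gt_eqF//.
  by rewrite !powRr1 ?(ltW s0)//; field; rewrite gt_eqF.
rewrite -(pK p)// -(pK q)//.
have := @conjugate_powR _ (p `^ p^-1 * A `^ p^-1 * t) (q `^ q^-1 * B `^ q^-1 * t)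
  p q _ _ p0 q0 pq.
rewrite !mulr_ge0 ?powR_ge0// => /(_ isT isT); apply: le_trans.
by rewrite le_eqVlt; apply/orP; left; apply/eqP; ring.
Qed.

(** Away from [x = 1] both sides are [(1 - x^(2m)) / (1 - x)]; induction avoids the division and so
    covers [x = 1], which occurs when [delta = 1]. *)
Lemma geometric_sum_sqr (R : comNzRingType) (x : R) (m : nat) :
  (1 + x) * \sum_(r < m) (x ^+ r) ^+ 2 = (1 + x ^+ m) * \sum_(r < m) x ^+ r.
Proof.
elim: m => [|m IH]; first by rewrite !big_ord0 !mulr0.
rewrite !big_ord_recr/= mulrDr IH.
have a : x ^+ m = 1 + (x - 1) * \sum_(r < m) x ^+ r.
  by rewrite -subrX1 addrC subrK.
by rewrite [x ^+ m.+1]exprS a; set s := \sum_(_ < _) _; ring.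
Qed.

Section Finite.
Variables (R : realType) (p q delta : R).
Hypotheses (p0 : 0 < p) (q0 : 0 < q) (pq : p^-1 + q^-1 = 1).
Hypothesis delta01 : 0 <= delta <= 1.

Lemma finite_maxconv_normalized_ge (X Y Z : seq int) (g h w : int -> R) :
  uniq X -> uniq Y -> uniq Z ->
  {in X & Y, forall x y, x + y \in Z /\ x + y + 1 \in Z} ->
  {in X, forall x, 0 <= g x <= 1} -> {in Y, forall y, 0 <= h y <= 1} ->
  (exists2 x, x \in X & g x = 1) -> (exists2 y, y \in Y & h y = 1) ->
  (forall z, 0 <= w z) ->
  {in X & Y, forall x y, g x * h y <= w (x + y) /\
    delta * (g x * h y) <= w (x + y + 1)} ->
  p `^ p^-1 * q `^ q^-1 / 2 * (1 + delta) *
    ((\sum_(x <- X) g x `^ p) `^ p^-1 * (\sum_(y <- Y) h y `^ q) `^ q^-1) <=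
  \sum_(z <- Z) w z.
Proof.
move=> uX uY uZ XYZ g01 h01 gmax hmax w0 ghw.
set A := \sum_(x <- X) _; set B := \sum_(y <- Y) _; set W := \sum_(z <- Z) _.
set c := p `^ p^-1 * q `^ q^-1 * (A `^ p^-1 * B `^ q^-1).
have A0 : 0 <= A by apply: sumr_ge0 => x _; exact: powR_ge0.
have B0 : 0 <= B by apply: sumr_ge0 => x _; exact: powR_ge0.
have c0 : 0 <= c by rewrite !mulr_ge0 ?powR_ge0.
rewrite mulrAC [_ / 2 * _]mulrAC -/c mulrAC.
have main eps m : 0 <= eps <= 1 -> (0 < m)%N -> eps ^+ m = delta ->
    c * (\sum_(r < m) (eps ^+ r) ^+ 2) <= W * (\sum_(r < m) eps ^+ r) + 1.
  move=> eps01 m0 epsm; subst delta.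
  have /andP[eps0 _] := eps01.
  apply: le_trans (spread_sumset_ge eps01 m0 p0 q0 pq uX uY uZ XYZ g01 h01
    gmax hmax w0 ghw).
  rewrite !mulr_sumr -big_split/=; apply: ler_sum => r _.
  by apply: young_powR => //; rewrite exprn_ge0.
have /andP[delta0 delta1] := delta01.
(* The error [1 / (m delta)] is useless at [delta = 0]. There [eps = 0] and [m = 1] give
   [c <= W + 1], and [1 <= W] turns this into [c <= 2 W]. *)
have [delta00|deltaN0] := eqVneq delta 0.
  have [x xX gx] := gmax; have [y yY hy] := hmax.
  have W1 : 1 <= W.
    have [xyZ _] := XYZ _ _ xX yY; have [+ _] := ghw _ _ xX yY.
    rewrite gx hy mulr1 => /le_trans; apply.
    by rewrite /W (big_rem (x + y))//= lerDl sumr_ge0.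
  have := main 0 1%N; rewrite lexx ler01 expr1 => /(_ isT isT (esym delta00)).
  by rewrite !big_ord1 expr0 delta00; lra.
have deltap : 0 < delta by rewrite lt_def deltaN0.
rewrite leNgt; apply/negP => Wc.
(* If the claim fails by [d > 0], [main] gives [d a <= 1] with [a] the sum of the [eps ^+ r]. Taking
   [m > 1 / (delta d)] contradicts this, since [a >= m delta]. *)
set d := c * (1 + delta) / 2 - W.
have d0 : 0 < d by rewrite /d subr_gt0.
pose m := (Num.trunc (delta * d)^-1).+1.
have mlt : (delta * d)^-1 < m%:R by exact: truncnS_gt.
have m0 : m%:R != 0 :> R by rewrite pnatr_eq0.
pose eps := delta `^ m%:R^-1.
have epsm : eps ^+ m = delta.
  by rewrite -powR_mulrn ?powR_ge0// -powRrM mulVf// powRr1.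
have eps0 : 0 <= eps by exact: powR_ge0.
have eps1 : eps <= 1.
  have -> : 1 = 1 `^ m%:R^-1 :> R by rewrite powR1.
  by rewrite ge0_ler_powR// nnegrE.
have := main eps m; rewrite eps0 eps1 => /(_ isT isT epsm).
have := geometric_sum_sqr eps m; rewrite epsm.
set T := \sum_(r < m) _; set a := \sum_(r < m) _ => Ta.
have T0 : 0 <= T by apply: sumr_ge0 => r _; rewrite sqr_ge0.
have am : m%:R * delta <= a.
  rewrite -[m in m%:R]card_ord -sum1_card natr_sum mulr_suml.
  apply: ler_sum => r _; rewrite mul1r -epsm.
  by apply: ler_wiXn2l => //; exact: ltnW.
have dm : 1 < d * a.
  apply: (@lt_le_trans _ _ (d * (m%:R * delta))); last by rewrite ler_wpM2l// ltW.
  rewrite mulrCA [d * delta]mulrC.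
  by move: mlt; rewrite -div1r ltr_pdivrMr ?mulr_gt0.
(* The identity for [T] and [eps <= 1] give [(1 + delta) a = (1 + eps) T <= 2 T]. *)
have cT : c * ((1 + delta) * a) <= c * (2 * T).
  by rewrite ler_wpM2l// -Ta ler_wpM2r// -[2]/(1 + 1 :> R) lerD2l.
move=> cTW; rewrite /d in dm; clear -dm cT cTW.
by clearbody c W a T; lra.
Qed.

Lemma finite_maxconv_ge (X Y Z : seq int) (g h w : int -> R) :
  uniq X -> uniq Y -> uniq Z ->
  {in X & Y, forall x y, x + y \in Z /\ x + y + 1 \in Z} ->
  (forall x, 0 <= g x) -> (forall y, 0 <= h y) -> (forall z, 0 <= w z) ->
  {in X & Y, forall x y, g x * h y <= w (x + y) /\
    delta * (g x * h y) <= w (x + y + 1)} ->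
  p `^ p^-1 * q `^ q^-1 / 2 * (1 + delta) *
    ((\sum_(x <- X) g x `^ p) `^ p^-1 * (\sum_(y <- Y) h y `^ q) `^ q^-1) <=
  \sum_(z <- Z) w z.
Proof.
move=> uX uY uZ XYZ g0 h0 w0 ghw.
(* Both sides are homogeneous in [g] and [h], so each is divided by its maximum, unless its norm on
   the list is 0 and the claim is trivial. *)
have zero_or_max (t : R) (s : seq int) (f : int -> R) : 0 < t ->
    (forall x, 0 <= f x) -> (\sum_(x <- s) f x `^ t) `^ t^-1 = 0 \/
    exists a, [/\ 0 < a, exists2 x, x \in s & a^-1 * f x = 1,
      {in s, forall x, 0 <= a^-1 * f x <= 1} &
      (\sum_(x <- s) f x `^ t) `^ t^-1 =
        a * (\sum_(x <- s) (a^-1 * f x) `^ t) `^ t^-1].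
  move=> t0 f0.
  have s0 (e : {in s, forall x, f x = 0}) : (\sum_(x <- s) f x `^ t) `^ t^-1 = 0.
    rewrite big_seq big1 ?powR0 ?invr_eq0 ?gt_eqF// => x xs.
    by rewrite e// powR0 ?gt_eqF.
  have [snil|sN0] := eqVneq s [::]; first by left; apply: s0; rewrite snil.
  have [|_ /mapP[x0 x0s ->] fmax] := @seq_max_mem _ _ [seq f x | x <- s].
    by case: (s) sN0.
  have fx0 x : x \in s -> f x <= f x0 by move=> xs; rewrite fmax ?map_f.
  have := f0 x0; rewrite le_eqVlt => /predU1P[e|a0].
    by left; apply: s0 => x xs; apply/le_anti; rewrite f0 e fx0.
  right; exists (f x0); split => //.
  - by exists x0 => //; rewrite mulVf ?gt_eqF.
  - move=> x xs; rewrite mulr_ge0 ?invr_ge0 ?(ltW a0)//=.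
    by rewrite mulrC ler_pdivrMr// mul1r fx0.
  - have -> : \sum_(x <- s) f x `^ t =
        f x0 `^ t * \sum_(x <- s) ((f x0)^-1 * f x) `^ t.
      rewrite mulr_sumr; apply: eq_bigr => x _.
      by rewrite -powRM ?mulr_ge0 ?invr_ge0// mulrA divff ?mul1r ?gt_eqF.
    rewrite powRM ?powR_ge0 ?sumr_ge0//; last by move=> *; exact: powR_ge0.
    by rewrite -powRrM divff ?gt_eqF// powRr1.
have W0 : 0 <= \sum_(z <- Z) w z by apply: sumr_ge0.
have [->|[a [a0 amax a1 ->]]] := zero_or_max p X g p0 g0.
  by rewrite mul0r mulr0.
have [->|[b [b0 bmax b1 ->]]] := zero_or_max q Y h q0 h0.
  by rewrite !mulr0.
have ab0 : 0 < a * b by rewrite mulr_gt0.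
have abV0 : 0 <= (a * b)^-1 by rewrite invr_ge0 ltW.
set k := _ / 2 * _; set A := _ `^ _; set B := _ `^ _.
have -> : k * (a * A * (b * B)) = a * b * (k * (A * B)) by ring.
rewrite -ler_pdivlMl// mulr_sumr.
apply: finite_maxconv_normalized_ge => // [z|x y xX yY]; first by rewrite mulr_ge0.
rewrite mulrACA -invfM; have [? ?] := ghw _ _ xX yY.
by split; rewrite 1?[delta * _]mulrCA ler_wpM2l.
Qed.

End Finite.

(** * From finite sums to sums over all integers *)

Section SumsOverZ.
Variable R : realType.
Implicit Types (F : int -> R) (p : R).

Local Notation total F := (\esum_(x in [set: int]) (F x)%:E)%E.

Lemma sum_le_esum F (s : seq int) :
  uniq s -> ((\sum_(x <- s) F x)%:E <= total F)%E.
Proof.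
move=> us; apply: esum_ge; exists [set` s]; first by split; [exact: finite_seq|].
by rewrite -fsbig_seq// sumEFin.
Qed.

Lemma esum_le F (M : \bar R) :
  (forall s, uniq s -> ((\sum_(x <- s) F x)%:E <= M)%E) -> (total F <= M)%E.
Proof.
move=> sM; apply: ge_ereal_sup => _ [A [finA _] <-].
by rewrite fsbig_finite// sumEFin sM// finmap.fset_uniq.
Qed.

Lemma esum_EFin_ge0 F : (forall x, 0 <= F x) -> (0 <= total F)%E.
Proof. by move=> F0; apply: esum_ge0 => x _; rewrite lee_fin. Qed.

(** For [K > 0] every finite sum is at most [(W / K) ^ p], hence so is the total. It serves to
    replace one finite norm by the full one, the other norm being absorbed in [K]. *)
Lemma esum_root_le F p (K W : R) : 0 < p -> 0 <= K -> 0 <= W ->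
  (forall x, 0 <= F x) -> (total F < +oo)%E ->
  (forall s, uniq s -> K * (\sum_(x <- s) F x) `^ p^-1 <= W) ->
  K * fine (total F) `^ p^-1 <= W.
Proof.
move=> p0 K0 W0 F0 Foo sW; have := K0.
rewrite le_eqVlt => /predU1P[<-|Kp]; first by rewrite mul0r.
have T0 := esum_EFin_ge0 F0.
have rootK (a : R) : 0 <= a -> (a `^ p^-1) `^ p = a.
  by move=> a0; rewrite -powRrM mulVf ?gt_eqF// powRr1.
have WK0 : 0 <= W / K by rewrite divr_ge0.
have : (total F <= ((W / K) `^ p)%:E)%E.
  apply: esum_le => s us; rewrite lee_fin.
  have S0 : 0 <= \sum_(x <- s) F x by exact: sumr_ge0.
  rewrite -[leLHS]rootK// ge0_ler_powR ?nnegrE ?powR_ge0 ?(ltW p0)//.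
  by rewrite ler_pdivlMr// mulrC sW.
rewrite -[X in (X <= _)%E]fineK ?ge0_fin_numE// lee_fin => le.
rewrite mulrC -ler_pdivlMr// -[leRHS]powRr1// -(divff (lt0r_neq0 p0)) powRrM.
by rewrite ge0_ler_powR ?nnegrE ?powR_ge0 ?invr_ge0 ?(ltW p0)// fine_ge0.
Qed.

Lemma esum_point (a : int) (c : R) : 0 <= c ->
  (\esum_(x in [set: int]) (if x == a then c else 0)%:E = c%:E)%E.
Proof.
move=> c0; have := @esum_set1 R int a (fun=> c%:E); rewrite lee_fin => <-//.
rewrite [RHS]esum_mkcond; apply: eq_esum => x _.
by have [->|/eqP xa] := eqVneq x a; [rewrite mem_set|rewrite memNset].
Qed.

End SumsOverZ.

(** * Max-convolutions over the integers and the bounds on [gamma_p] *)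

Section Maxconv.
Variable R : realType.
Implicit Types f g h : int -> R.

(** Boundedness makes [sup] a genuine supremum here, not the default value it takes on unbounded
    sets. *)
Lemma maxconv_bound f g (A B : R) : (forall x, 0 <= f x <= A) ->
  (forall x, 0 <= g x <= B) ->
  (forall t x, f t * g (x - t) <= maxconv f g x) /\
  (forall x, 0 <= maxconv f g x <= A * B).
Proof.
move=> fA gB.
have ub x : ubound [set f t * g (x - t) | t in [set: int]] (A * B).
  move=> _ [t _ <-]; have /andP[? ?] := fA t; have /andP[? ?] := gB (x - t).
  exact: ler_pM.
have ge t x : f t * g (x - t) <= maxconv f g x.
  by apply: ub_le_sup; [exists (A * B); exact: ub|exists t].
split=> // x; apply/andP; split.
  apply: le_trans (ge 0 x); have /andP[? _] := fA 0.
  by have /andP[? _] := gB (x - 0); rewrite mulr_ge0.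
by apply: ge_sup; [exists (f 0 * g (x - 0)), 0|exact: ub].
Qed.

Lemma fdelta_bound (delta : R) x : 0 <= delta <= 1 -> 0 <= fdelta delta x <= 1.
Proof.
move=> /andP[? ?]; rewrite /fdelta.
by have [->|] := eqVneq x 0; have [|] := eqVneq x 1 => //=; lra.
Qed.

Lemma admissible_bound g : admissible g -> exists M, forall x, 0 <= g x <= M.
Proof.
case=> g0 [_ goo]; exists (fine (l1norm g)) => x; rewrite g0/=.
have n0 : (0 <= l1norm g)%E by apply: esum_EFin_ge0 => y; exact: normr_ge0.
rewrite -lee_fin fineK ?ge0_fin_numE//.
have := @sum_le_esum R (fun x => `|g x|) [:: x] isT.
by rewrite big_seq1 ger0_norm.
Qed.

(** A summable [g] is bounded by some [M], and then [g ^ p <= M ^ (p - 1) g] pointwise. *)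
Lemma admissible_lp_lty (p : R) g : 1 < p -> admissible g ->
  (\esum_(x in [set: int]) (`|g x| `^ p)%:E < +oo)%E.
Proof.
move=> p1 adm; have [M gM] := admissible_bound adm.
have M0 : 0 <= M by have /andP[] := gM 0; exact: le_trans.
case: adm => g0 [_ goo].
have n0 : (0 <= l1norm g)%E by apply: esum_EFin_ge0 => y; exact: normr_ge0.
apply: (@le_lt_trans _ _ ((M `^ (p - 1))%:E * l1norm g)%E); last first.
  by rewrite -[l1norm g]fineK ?ge0_fin_numE// -EFinM ltry.
apply: esum_le => s us.
apply: (@le_trans _ _ ((M `^ (p - 1))%:E * (\sum_(x <- s) `|g x|)%:E)%E).
  rewrite -EFinM lee_fin mulr_sumr; apply: ler_sum => x _.
  have /andP[gx0 gxM] := gM x.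
  rewrite ger0_norm// -mulr_powRB1 ?(lt_trans _ p1)// mulrC ler_wpM2r//.
  by rewrite ge0_ler_powR ?nnegrE ?subr_ge0// ltW.
by apply: lee_wpmul2l; [rewrite lee_fin powR_ge0|exact: sum_le_esum].
Qed.

(** One nonzero value makes the norm positive; finiteness matters as well, because [fine] sends
    [+oo] to 0. *)
Lemma admissible_lpnorm_gt0 (p : R) g : 1 < p -> admissible g ->
  0 < fine (lpnorm p g).
Proof.
move=> p1 adm; have := admissible_lp_lty p1 adm; case: adm => g0 [[x gx] _] oo.
rewrite fine_poweR powR_gt0// -lte_fin fineK; last first.
  by rewrite ge0_fin_numE// esum_EFin_ge0// => y; exact: powR_ge0.
have := @sum_le_esum R (fun x => `|g x| `^ p) [:: x] isT.
rewrite big_seq1; apply: lt_le_trans.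
by rewrite lte_fin powR_gt0 ?normr_gt0.
Qed.

Lemma maxconv_fdelta_lpnorm_ge (delta p q : R) g h :
  0 <= delta <= 1 -> 1 < p -> 1 < q -> p^-1 + q^-1 = 1 ->
  admissible g -> admissible h ->
  ((p `^ p^-1 * q `^ q^-1 / 2 * (1 + delta) *
    (fine (lpnorm p g) * fine (lpnorm q h)))%:E <=
   l1norm (maxconv (maxconv (fdelta delta) g) h))%E.
Proof.
move=> delta01 p1 q1 pq admg admh.
have p0 : 0 < p by exact: lt_trans p1.
have q0 : 0 < q by exact: lt_trans q1.
have [A gA] := admissible_bound admg.
have [B hB] := admissible_bound admh.
have [u_ge u_bd] := maxconv_bound (fun x => fdelta_bound x delta01) gA.
have [w_ge w_bd] := maxconv_bound u_bd hB.
set u := maxconv (fdelta delta) g in u_ge u_bd w_ge w_bd *.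
set w := maxconv u h in w_ge w_bd *.
have g0 x : 0 <= g x by case/andP: (gA x).
have h0 x : 0 <= h x by case/andP: (hB x).
have w0 x : 0 <= w x by case/andP: (w_bd x).
(* The two points 0 and 1 of the support of [fdelta] give the two bounds on [u], and through it
   those on [w]. *)
have u_g x : g x <= u x.
  by have := u_ge 0 x; rewrite /fdelta/= subr0 mulr0 addr0 mul1r.
have u_dg x : delta * g x <= u (x + 1).
  by have := u_ge 1 (x + 1); rewrite /fdelta/= addrK add0r mulr1.
have w_gh x y : g x * h y <= w (x + y).
  apply: le_trans (w_ge x (x + y)); rewrite [x + y]addrC addrK.
  by rewrite ler_wpM2r.
have w_dgh x y : delta * (g x * h y) <= w (x + y + 1).
  apply: le_trans (w_ge (x + 1) (x + y + 1)).
  have -> : x + y + 1 - (x + 1) = y by ring.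
  by rewrite mulrA ler_wpM2r.
have n0 : (0 <= l1norm w)%E by apply: esum_EFin_ge0 => y; exact: normr_ge0.
have [woo|] := ltP (l1norm w) +oo%E; last first.
  by rewrite leye_eq => /eqP ->; exact: leey.
set k := p `^ p^-1 * q `^ q^-1 / 2 * (1 + delta).
have k0 : 0 <= k.
  by case/andP: delta01 => ? _; rewrite !mulr_ge0 ?powR_ge0 ?addr_ge0 ?invr_ge0.
have fin X Y : uniq X -> uniq Y ->
    k * ((\sum_(x <- X) g x `^ p) `^ p^-1 * (\sum_(y <- Y) h y `^ q) `^ q^-1) <=
    fine (l1norm w).
  move=> uX uY; pose S := [seq x + y | x <- X, y <- Y].
  pose Z := undup (S ++ [seq z + 1 | z <- S]).
  have uZ : uniq Z by exact: undup_uniq.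
  apply: (@le_trans _ _ (\sum_(z <- Z) w z)); last first.
    rewrite -lee_fin fineK ?ge0_fin_numE//.
    rewrite (eq_bigr (fun z => `|w z|)); last by move=> z _; rewrite ger0_norm.
    exact: sum_le_esum.
  apply: finite_maxconv_ge => // x y xX yY.
  have xyS : x + y \in S by apply/allpairsP; exists (x, y).
  by rewrite !mem_undup !mem_cat xyS (map_f (fun z => z + 1) xyS) orbT.
rewrite -[leRHS]fineK ?ge0_fin_numE// lee_fin !fine_poweR.
(* The full norms are reached one at a time: first that of [h], then that of [g] with the finite set
   [Y] fixed. *)
rewrite mulrA; apply: esum_root_le; rewrite ?fine_ge0 ?admissible_lp_lty//.
  by rewrite mulr_ge0 ?powR_ge0.
move=> Y uY; rewrite mulrAC; apply: esum_root_le;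
  rewrite ?fine_ge0 ?admissible_lp_lty//.
  by rewrite mulr_ge0 ?powR_ge0.
move=> X uX; rewrite mulrAC -mulrA.
under eq_bigr do rewrite ger0_norm//.
under [in X in _ * (_ * X)]eq_bigr do rewrite ger0_norm//.
exact: fin.
Qed.

Lemma conj_exp_gt1 (p : R) : 1 < p -> 1 < conj_exp p.
Proof. by move=> p1; rewrite /conj_exp ltr_pdivlMr ?subr_gt0// mul1r; lra. Qed.

Lemma conj_expE (p : R) : 1 < p -> p^-1 + (conj_exp p)^-1 = 1.
Proof. by move=> p1; rewrite /conj_exp; field; lra. Qed.

Lemma gamma_p_fdelta_ge (delta p : R) : 0 <= delta <= 1 -> 1 < p ->
  ((p `^ p^-1 * conj_exp p `^ (conj_exp p)^-1 / 2 * (1 + delta))%:E <=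
   gamma_p p (fdelta delta))%E.
Proof.
move=> delta01 p1; apply: le_ereal_inf_tmp => _ [g [h [admg [admh ->]]]].
have q1 := conj_exp_gt1 p1.
have := maxconv_fdelta_lpnorm_ge delta01 p1 q1 (conj_expE p1) admg admh.
have : 0 < fine (lpnorm p g) * fine (lpnorm (conj_exp p) h).
  by rewrite mulr_gt0 ?admissible_lpnorm_gt0.
set N := fine _ * _ => N0.
case: (l1norm _) => [W|_|//].
  by rewrite -EFinM !lee_fin ler_pdivlMr.
by rewrite gt0_mulye ?leey// lte_fin invr_gt0.
Qed.

Definition dirac0 : int -> R := fun x => if x == 0 then 1 else 0.

Lemma maxconv_dirac0 f : (forall x, 0 <= f x) -> maxconv f dirac0 = f.
Proof.
move=> f0; apply/funext => x; rewrite /maxconv.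
(* Only [t = x] gives a product that may be nonzero, and the zeros elsewhere do not exceed [f x]. *)
have ub : ubound [set f t * dirac0 (x - t) | t in [set: int]] (f x).
  move=> _ [t _ <-]; rewrite /dirac0 subr_eq0.
  by case: eqP => [->|_]; rewrite ?mulr1 ?mulr0.
have fx : [set f t * dirac0 (x - t) | t in [set: int]] (f x).
  by exists x => //; rewrite /dirac0 subrr eqxx mulr1.
apply/le_anti/andP; split; first by apply: ge_sup => //; exists (f x).
by apply: ub_le_sup => //; exists (f x).
Qed.

Lemma gamma_fdelta_le (delta : R) : 0 <= delta <= 1 ->
  (gamma (fdelta delta) <= (1 + delta)%:E)%E.
Proof.
move=> delta01; have /andP[delta0 _] := delta01.
have f0 x : 0 <= fdelta delta x by case/andP: (fdelta_bound x delta01).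
have dirac_ge0 x : 0 <= dirac0 x by rewrite /dirac0; case: ifP.
have n1 : l1norm dirac0 = 1%E.
  rewrite -(@esum_point R 0 1)//; apply: eq_esum => x _.
  by rewrite ger0_norm.
have n2 : lpnorm 2 dirac0 = 1%E.
  rewrite /lpnorm (eq_esum (b := fun x => (if x == 0 then 1 else 0)%:E)).
    by rewrite esum_point// poweR1r.
  move=> x _; rewrite ger0_norm// /dirac0.
  by case: ifP; rewrite ?powR1// powR0.
have adm : admissible dirac0.
  by split=> //; split; [exists 0; rewrite /dirac0 eqxx oner_eq0|rewrite n1 ltry].
(* With this pair the triple max-convolution is [fdelta delta] and both norms are 1. *)
apply: ereal_inf_lbound; exists dirac0, dirac0; split=> //; split=> //.
have -> : conj_exp 2 = 2 :> R by rewrite /conj_exp; field.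
rewrite n2 mulr1 invr1 mule1 !maxconv_dirac0//.
rewrite /l1norm (eq_esum (b := fun x => ((if x == 0 then 1 else 0)%:E +
  (if x == 1 then delta else 0)%:E)%E)).
  rewrite esumD; [|by move=> x _; rewrite lee_fin; case: ifP..].
  by rewrite !esum_point// EFinD.
move=> x _; rewrite ger0_norm// /fdelta EFinD.
by case: (x == 1); rewrite ?mulr1 ?mulr0.
Qed.

End Maxconv.

Theorem mainTheorem14 (R : realType) (delta : R) :
  0 <= delta <= 1 ->
  gamma (fdelta delta) = (1 + delta)%:E /\
  (forall p : R, 1 < p ->
     Order.le
       ((powR p p^-1 * powR (conj_exp p) (conj_exp p)^-1) / 2 * (1 + delta))%:E
       (gamma_p p (fdelta delta))).
Proof.
move=> delta01; split; last by move=> p; exact: gamma_p_fdelta_ge.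
apply/le_anti; rewrite gamma_fdelta_le//=.
have := @gamma_p_fdelta_ge R delta 2 delta01; rewrite ltr1n => /(_ isT).
have -> : conj_exp 2 = 2 :> R by rewrite /conj_exp; field.
(* At [p = q = 2] the constant is [2^(1/2) 2^(1/2) / 2 = 1]. *)
rewrite -powRD; last by rewrite gt_eqF// addr_gt0.
have -> : 2^-1 + 2^-1 = 1 :> R by field.
by rewrite powRr1// divff// mul1r.
Qed.
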